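(* For a fixed $\beta\in\mathbb R^p$, let $$W_n(\beta,x)=\int\Big(e^{\beta'z}\int_0^x\{u\ge s\}\,ds\Big)\,d\mathbb P_n(u,\delta,z),\qquad V_n(x)=\int\delta\{u<x\}\,d\mathbb P_n(u,\delta,z),\qquad x\ge0.$$ Then the nonparametric maximum likelihood estimator (NPMLE) $\hat\lambda_n(x;\beta)$ of a nondecreasing baseline hazard function $\lambda_0$ (as defined in the context) is of the form $$\hat\lambda_n(x;\beta)=\begin{cases}0 & x<T_{(1)},\\ \hat\lambda_i & T_{(i)}\le x<T_{(i+1)},\ i=1,2,\dots,n-1,\\ \infty & x\ge T_{(n)},\end{cases}$$ where $\hat\lambda_i$ is the left derivative of the greatest convex minorant at the point $P_i$ of the cumulative sum diagram consisting of the points $$P_j=\Big(W_n(\beta,T_{(j+1)})-W_n(\beta,T_{(1)}),\ V_n(T_{(j+1)})\Big),\qquad j=1,2,\dots,n-1,$$ and $P_0=(0,0)$. Furthermore, for $i=1,2,\dots,n-1$, $$\hat\lambda_i=\max_{1\le s\le i}\ \min_{i\le t\le n-1}\frac{\sum_{j=s}^t\Delta_{(j)}}{\sum_{j=s}^t\big(T_{(j+1)}-T_{(j)}\big)\sum_{l=j+1}^n e^{\beta'Z_{(l)}}}.$$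
   Context: Data: $(T_i,\Delta_i,Z_i)$, $i=1,\dots,n$, with follow-up times $T_i\geq 0$, censoring indicators $\Delta_i\in\{0,1\}$ and covariates $Z_i\in\mathbb R^p$, from the Cox model with conditional hazard $\lambda_0(x)e^{\beta_0'z}$ given $Z=z$. $T_{(1)}<T_{(2)}<\dots<T_{(n)}$ are the ordered (distinct) follow-up times, and $\Delta_{(i)},Z_{(i)}$ are the censoring indicator and covariate corresponding to $T_{(i)}$. $\mathbb P_n$ is the empirical measure of the $(T_i,\Delta_i,Z_i)$, and $\{\cdot\}$ denotes an indicator. The (pseudo) loglikelihood, for $\beta$ fixed, is $$\sum_{i=1}^n\Big[\Delta_i\log\lambda_0(T_i)+\Delta_i\beta'Z_i-e^{\beta'Z_i}\Lambda_0(T_i)\Big],\qquad \Lambda_0(x)=\int_0^x\lambda_0(u)\,du.$$ Since $\lambda_0(T_{(n)})$ can be chosen arbitrarily large, the NPMLE of a nondecreasing baseline hazard is defined as follows: for $M>0$ (large) let $\hat\lambda_n^M(\cdot;\beta)$ be the maximizer of this loglikelihood over all nondecreasing $\lambda_0\geq 0$ bounded by $M$, and let $\hat\lambda_n(x;\beta)=\lim_{M\to\infty}\hat\lambda_n^M(x;\beta)$. On $[T_{(n)},\infty)$, where the maximizer need not be determined, $\hat\lambda_n^M$ is given the value $M$. *)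

(* Defs.v *)
From HB Require Import structures.
From mathcomp Require Import all_boot all_order all_algebra.
From mathcomp Require Import all_classical all_reals all_analysis.

Set Implicit Arguments.
Unset Strict Implicit.
Unset Printing Implicit Defensive.

Import Order.TTheory GRing.Theory Num.Theory.
Import numFieldNormedType.Exports.

Local Open Scope classical_set_scope.
Local Open Scope ring_scope.

(* One observation is a triple (follow-up time, censoring indicator, covariate);
   the indicator is [true] when the event is observed. Covariates are tuples,
   which carry the product sigma-algebra. *)
Notation obs R p := (R * bool * p.-tuple R)%type.

Section Sample.
Variables (R : realType) (p : nat).
Implicit Types (o : obs R p) (beta z : p.-tuple R).

Definition time o : R := o.1.1.
Definition event o : bool := o.1.2.
Definition covar o : p.-tuple R := o.2.

Definition dotp beta z : R := \sum_(k < p) tnth beta k * tnth z k.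

(* Default value for [nth]; never reached for the indices in use. *)
Definition obs0 : obs R p := (0, false, nseq_tuple p 0).

Variables (n : nat) (X : n.-tuple (obs R p)).

Definition emp : {measure set (obs R p) -> \bar R} :=
  mscale (n%:R^-1)%:nng (msum (fun k => \d_(nth obs0 X k)) n).

(* Order statistics, indexed from 1. *)
Definition ordered (i : nat) : obs R p :=
  nth obs0 (sort (relpre time <=%R) X) i.-1.
Definition Tord i : R := time (ordered i).
Definition Dord i : bool := event (ordered i).
Definition Zord i : p.-tuple R := covar (ordered i).

Definition Wn beta (x : R) : R :=
  \int[emp]_o (expR (dotp beta (covar o)) *
    \int[lebesgue_measure]_(s in `[0, x]) (s <= time o)%R%:R).

Definition Vn (x : R) : R :=
  \int[emp]_o ((event o)%:R * (time o < x)%R%:R).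

Definition csd beta (j : nat) : R * R :=
  if j is 0%N then (0, 0)
  else (Wn beta (Tord j.+1) - Wn beta (Tord 1), Vn (Tord j.+1)).

(* With values in \bar R: [lne 0 = -oo] and [0 * -oo = 0], so a hazard vanishing
   at an uncensored time has loglikelihood -oo, while the first term vanishes at
   censored times. *)
Definition loglik beta (lam : R -> R) : \bar R :=
  (\sum_(o <- X)
     ((event o)%:R%:E * lne (lam (time o))%:E
      + ((event o)%:R * dotp beta (covar o))%:E
      - (expR (dotp beta (covar o)))%:E
        * \int[lebesgue_measure]_(u in `[0%R, time o]) (lam u)%:E))%E.

(* Hazards are functions on [0, +oo); their values at negative arguments are
   irrelevant. *)
Definition feasible (M : R) (lam : R -> R) : Prop :=
  {in `[0, +oo[ &, {homo lam : x y / x <= y}} /\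
  {in `[0, +oo[, forall x, 0 <= lam x <= M}.

Definition sieve_max beta (M : R) (lam : R -> R) : Prop :=
  [/\ feasible M lam,
      forall mu, feasible M mu -> (loglik beta mu <= loglik beta lam)%E
    & forall x, 0 <= x -> Tord n <= x -> lam x = M].

Definition sieve_mle beta (M : R) (lam : R -> R) : Prop :=
  sieve_max beta M lam /\
  forall mu, sieve_max beta M mu -> {in `[0, +oo[, mu =1 lam}.

Definition is_npmle beta (lam : R -> \bar R) : Prop :=
  exists lamM : R -> R -> R,
    (\forall M \near +oo, sieve_mle beta M (lamM M)) /\
    (forall x, 0 <= x -> (lamM M x)%:E @[M --> +oo] --> lam x).

End Sample.

Section GreatestConvexMinorant.
Variable R : realType.

(* [P 0], ..., [P m] are the points of the diagram, with increasing abscissas. *)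
Definition convex_minorant (P : nat -> R * R) (m : nat) (g : R -> R) : Prop :=
  convex_function (`[(P 0%N).1, (P m).1]%classic : set R^o) g /\
  forall j, (j <= m)%N -> g (P j).1 <= (P j).2.

Definition gcm (P : nat -> R * R) (m : nat) (x : R) : R :=
  sup [set g x | g in [set g | convex_minorant P m g]].

Definition left_derivative (f : R -> R) (x l : R) : Prop :=
  (f (x + h) - f x) / h @[h --> 0^'-] --> l.

End GreatestConvexMinorant.

(* Main.v *)
(** A nondecreasing hazard with prescribed values at the observed times has the
    largest likelihood when it is constant between consecutive times, so that for
    values [mu k] at [T_(k+1)] (indices from 0) the problem is to maximize
    [\sum_k (d k * ln (mu k) - w k * mu k)] over nonnegative nondecreasing
    sequences [mu], where [w k] is the total risk accumulated on [[T_(k+1), T_(k+2))].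
    Let [lam] be the isotonic regression of [d / w] with weights [w]: the partial
    sums of [d - w * lam] are nonnegative, and vanish at the end and wherever [lam]
    jumps. Summation by parts then gives, for every competitor [mu],
    [\sum d * ln mu <= \sum w * lam * ln mu], with equality for [mu = lam], and
    [y |-> x * ln y - y] has its unique maximum over [y >= 0] at [y = x]. The places
    where the partial sums vanish are the contact points of the cumulative sum
    diagram with its greatest convex minorant; they give both the left derivatives
    and the max-min formula. *)
Require Import Defs.
From HB Require Import structures.
From mathcomp Require Import all_boot all_order all_algebra.
From mathcomp Require Import all_classical all_reals all_analysis.
From mathcomp Require Import measurable_realfun ring lra zify.
Set Implicit Arguments.
Unset Strict Implicit.
Import Order.TTheory GRing.Theory Num.Theory.
Import numFieldNormedType.Exports.
Local Open Scope classical_set_scope.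
Local Open Scope ring_scope.

(** * Isotonic regression *)

Section IsotonicFit.
Context {R : realFieldType}.
Implicit Types (m : nat) (d w lam : nat -> R).

(** Optimality conditions of the regression, read on the diagram with increments [(w, d)]: the
    partial sum up to [k] is the height of the diagram over the polygon with slopes [lam], which
    touches it at both ends and bends only at contacts. *)
Record isotonic_fit m d w lam : Prop := IsotonicFit {
  fit_mono : forall j, (j.+1 < m)%N -> lam j <= lam j.+1;
  fit_ge0 : forall k, (k <= m)%N -> 0 <= \sum_(0 <= j < k) (d j - w j * lam j);
  fit_end : \sum_(0 <= j < m) (d j - w j * lam j) = 0;
  fit_const : forall k, (k.+1 < m)%N ->
    \sum_(0 <= j < k.+1) (d j - w j * lam j) = 0 \/ lam k = lam k.+1 }.

(** Up to the first contact after 0 the fit is constant. Serves to compare [lam 0] with averages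
    over prefixes. *)
Lemma fit_head m d w lam : (0 < m)%N -> isotonic_fit m d w lam ->
  exists k, [/\ (0 < k)%N, (k <= m)%N &
    \sum_(0 <= j < k) d j = lam 0%N * \sum_(0 <= j < k) w j].
Proof.
move=> m_gt0 [_ _ Sm Sc].
pose tight k := (0 < k <= m)%N && (\sum_(0 <= j < k) (d j - w j * lam j) == 0).
have ext : exists k, tight k by exists m; rewrite /tight m_gt0 leqnn Sm eqxx.
case: (ex_minnP ext) => k /andP[/andP[k_gt0 km] /eqP Sk] kmin.
have cst j : (j < k)%N -> lam j = lam 0%N.
  elim: j => // j ih jk; rewrite -ih ?(ltn_trans _ jk)//.
  case: (Sc j (leq_trans jk km)) => [S0|->//].
  have /kmin : tight j.+1 by rewrite /tight /= S0 eqxx andbT ltnW// (leq_trans jk).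
  by rewrite leqNgt jk.
exists k; split=> //; move: Sk; rewrite sumrB => /eqP; rewrite subr_eq0 => /eqP ->.
by rewrite mulr_sumr; apply: eq_big_nat => j /andP[_ jk]; rewrite cst// mulrC.
Qed.

(* The fit is constant on a prefix minimizing the averages of d with respect to w;
   the remaining indices are fitted recursively. *)
Lemma fit_exists m d w : (forall j, (j < m)%N -> 0 < w j) ->
  exists lam, isotonic_fit m d w lam.
Proof.
elim/ltn_ind: m d w => -[|m] ih d w w_gt0.
  by exists (fun=> 0); split=> // [[|k]//|]; rewrite big_geq.
pose W k := \sum_(0 <= j < k) w j; pose D k := \sum_(0 <= j < k) d j.
have W_gt0 k : (k < m.+1)%N -> 0 < W k.+1.
  move=> km; rewrite /W big_nat_recr//= ltr_wpDl ?w_gt0// big_nat_cond sumr_ge0// => j.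
  by rewrite andbT => /andP[_ jk]; rewrite ltW// w_gt0// (ltn_trans jk).
pose a := [arg min_(i < ord0 : 'I_m.+1) (D i.+1 / W i.+1)]%O.
pose c := D a.+1 / W a.+1.
have cP k : (k < m.+1)%N -> c * W k.+1 <= D k.+1.
  move=> km; rewrite -ler_pdivlMr ?W_gt0// /c /a.
  by case: arg_minP => // i _ /(_ (Ordinal km) isT).
have Sc k : \sum_(0 <= j < k) (d j - w j * c) = D k - c * W k.
  by rewrite sumrB -mulr_suml mulrC.
have Sa : \sum_(0 <= j < a.+1) (d j - w j * c) = 0.
  by rewrite Sc /c divfK ?subrr// gt_eqF// W_gt0.
have am : (a < m.+1)%N by [].
pose d' j := d (a.+1 + j)%N; pose w' j := w (a.+1 + j)%N.
have [] := ih (m.+1 - a.+1)%N _ d' w'.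
- by rewrite subSS ltnS leq_subr.
- by move=> j; rewrite ltn_subRL => jm; exact: w_gt0.
move=> lam' fit'.
pose lam j := if (j < a.+1)%N then c else lam' (j - a.+1)%N.
have shift (F : nat -> R) k : \sum_(0 <= j < a.+1 + k) F j =
    \sum_(0 <= j < a.+1) F j + \sum_(0 <= j < k) F (a.+1 + j)%N.
  by rewrite !big_mkord big_split_ord.
have Slo k : (k <= a.+1)%N ->
    \sum_(0 <= j < k) (d j - w j * lam j) = \sum_(0 <= j < k) (d j - w j * c).
  move=> ka; apply: eq_big_nat => j /andP[_ jk].
  by rewrite /lam (leq_trans jk).
have Shi k : \sum_(0 <= j < a.+1 + k) (d j - w j * lam j) =
    \sum_(0 <= j < k) (d' j - w' j * lam' j).
  rewrite shift Slo// Sa add0r; apply: eq_bigr => j _.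
  by rewrite /lam ltnNge leq_addr/= addKn.
case: (fit') => mono' ge0' end' const'.
(* The two pieces join monotonically: the first block of [lam'], appended to the prefix, gives a
   longer prefix, whose average is at least [c] by minimality, while the prefix alone averages
   [c]. *)
have hd' : (a.+1 < m.+1)%N -> c <= lam' 0%N.
  move=> am'; have m'_gt0 : (0 < m.+1 - a.+1)%N by rewrite subn_gt0.
  have [[[]//|k [_ km E]]] := fit_head m'_gt0 fit'.
  have akm : (a.+1 + k < m.+1)%N by rewrite -ltn_subRL.
  have W'_gt0 : 0 < \sum_(0 <= j < k.+1) w' j.
    rewrite big_nat_recr//= ltr_wpDl ?w_gt0// big_nat_cond sumr_ge0// => j.
    rewrite andbT => /andP[_ jk]; apply/ltW/w_gt0.
    by rewrite (leq_trans _ akm)// ltnS leq_add2l ltnW.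
  have := cP _ akm; rewrite /W /D -addnS !shift -!/(D _) -!/(W _) -/d' -/w'.
  have -> : D a.+1 = c * W a.+1 by rewrite /c divfK// gt_eqF// W_gt0.
  by rewrite E mulrDr lerD2l ler_pM2r.
exists lam; split.
- move=> j jm; rewrite /lam; case: (ltngtP j.+1 a.+1) => [//|ja|[ja]].
  + by rewrite subSn//; apply: mono'; lia.
  + by rewrite ja subnn hd'// -ja.
- move=> k km; have [ka|ka] := leqP k a.+1.
    rewrite Slo// Sc subr_ge0; case: k km ka => [|k] km ka; last exact: cP.
    by rewrite /W /D !big_geq// mulr0.
  rewrite -(subnKC (ltnW ka)) Shi; apply: ge0'.
  exact: leq_sub2r.
- by rewrite -(subnKC am) Shi end'.
- move=> k km; rewrite {2 3}/lam; case: (ltngtP k.+1 a.+1) => [|ka|[ka]]; first by right.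
  + have -> : k.+1 = (a.+1 + (k - a.+1).+1)%N by lia.
    by rewrite Shi addKn; apply: const'; lia.
  + by left; rewrite ka Slo.
Qed.

Lemma fit_le m d w lam j k : isotonic_fit m d w lam -> (j <= k)%N -> (k < m)%N ->
  lam j <= lam k.
Proof.
case=> mono _ _ _ /subnKC <-; elim: (k - j)%N => [|l ih] jl; first by rewrite addn0.
by rewrite addnS in jl *; rewrite (le_trans (ih (ltnW jl)))// mono.
Qed.

(** The diagram carries the factor [1 / n] of the empirical measure and the likelihood does not; the
    same fit serves both. *)
Lemma fit_scale c m d w d' w' lam : 0 < c ->
  (forall j, (j < m)%N -> d' j = c * d j) -> (forall j, (j < m)%N -> w' j = c * w j) ->
  isotonic_fit m d w lam -> isotonic_fit m d' w' lam.
Proof.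
move=> c_gt0 d'E w'E [mono ge0 Sm const].
have scale k : (k <= m)%N -> \sum_(0 <= j < k) (d' j - w' j * lam j) =
    c * \sum_(0 <= j < k) (d j - w j * lam j).
  move=> km; rewrite mulr_sumr; apply: eq_big_nat => j /andP[_ jk].
  by rewrite d'E ?w'E ?mulrBr ?mulrA//; apply: leq_trans km.
split=> //.
- by move=> k km; rewrite scale// mulr_ge0 ?ge0// ltW.
- by rewrite scale// Sm mulr0.
- move=> k km; rewrite scale; last exact: ltnW.
  by have [->|->] := const k km; [left; rewrite mulr0|right].
Qed.

(* The block [a, b) of constancy of lam around i, delimited by two contact points
   of the diagram with its minorant, through which the line of slope lam i
   supports the diagram. *)
Lemma fit_block m d w lam i : (forall j, (j < m)%N -> 0 < w j) ->
  isotonic_fit m d w lam -> (i < m)%N ->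
  exists a b, [/\ (a <= i < b)%N && (b <= m)%N,
    forall t, (a <= t <= m)%N ->
      lam i * \sum_(a <= j < t) w j <= \sum_(a <= j < t) d j,
    forall s, (s <= a)%N ->
      \sum_(s <= j < a) d j <= lam i * \sum_(s <= j < a) w j &
    forall s, (s <= b)%N ->
      \sum_(s <= j < b) d j <= lam i * \sum_(s <= j < b) w j].
Proof.
move=> w_gt0 fit im; case: (fit) => mono ge0 Sm const.
(* [a] is the last contact up to [i] and [b] the first one after [i], so [lam] does not change
   between them. *)
pose S k := \sum_(0 <= j < k) (d j - w j * lam j).
have ea : exists k, (k <= i)%N && (S k == 0) by exists 0%N; rewrite /S big_geq ?eqxx.
have ba k : (k <= i)%N && (S k == 0) -> (k <= i)%N by case/andP.
case: (ex_maxnP ea ba) => a /andP[ai /eqP Sa] amax.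
have eb : exists k, (i < k <= m)%N && (S k == 0) by exists m; rewrite im leqnn /S Sm eqxx.
case: (ex_minnP eb) => b /andP[/andP[ib bm] /eqP Sb] bmin.
have cst_up j : (i <= j < b)%N -> lam j = lam i.
  case/andP; move=> /subnKC <-; elim: (j - i)%N => [|l ih] jb; first by rewrite addn0.
  rewrite addnS in jb *; rewrite -ih ?(ltnW jb)//.
  case: (const _ (leq_trans jb bm)) => [S0|->//].
  have /bmin : (i < (i + l).+1 <= m)%N && (S (i + l).+1 == 0).
    by rewrite ltnS leq_addr (ltnW (leq_trans jb bm)) /S S0 eqxx.
  by rewrite leqNgt jb.
have cst_dn l : (a + l <= i)%N -> lam (i - l)%N = lam i.
  elim: l => [|l ih] al; first by rewrite subn0.
  have li : (l < i)%N by lia.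
  rewrite -ih; last lia.
  have E : (i - l = (i - l.+1).+1)%N by lia.
  rewrite E; case: (const (i - l.+1)%N) => [|S0|//]; first lia.
  have /amax : ((i - l.+1).+1 <= i)%N && (S (i - l.+1).+1 == 0).
    by rewrite /S S0 eqxx andbT; lia.
  lia.
have lama : lam a = lam i by rewrite -(cst_dn (i - a)%N) ?subKn// subnKC.
have lamb j : (j < b)%N -> lam j <= lam i.
  move=> jb; have [ij|ij] := leqP i j; first by rewrite cst_up// ij.
  by apply: (fit_le fit) => //; exact: ltnW.
(* A sum ending at a contact: nonnegativity of [S s] makes the residuals over [[s, b')] sum to at
   most 0, and [lam j <= lam i] there. Used with [b'] equal to [a] and to [b]. *)
have above s b' : (s <= b')%N -> (b' <= b)%N -> S b' = 0 ->
    \sum_(s <= j < b') d j <= lam i * \sum_(s <= j < b') w j.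
  move=> sb b'b Sb'; have := ge0 s (leq_trans sb (leq_trans b'b bm)).
  rewrite -/(S s); move: Sb'; rewrite /S (big_cat_nat (leq0n s) sb)/= -/(S s) => Sb' Ss.
  have : \sum_(s <= j < b') (d j - w j * lam j) <= 0 by lra.
  rewrite sumrB subr_le0 => /le_trans; apply.
  rewrite mulr_sumr; apply: ler_sum_nat => j /andP[_ jb].
  by rewrite mulrC ler_pM2r ?lamb ?w_gt0//; lia.
exists a, b; split.
- by rewrite ai ib.
- move=> t /andP[at_ tm]; have := ge0 t tm.
  rewrite (big_cat_nat (leq0n a) at_)/= -/(S a) Sa add0r sumrB subr_ge0.
  apply: le_trans; rewrite mulr_sumr; apply: ler_sum_nat => j /andP[aj jt].
  rewrite mulrC ler_pM2l ?w_gt0//; last lia.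
  by rewrite -lama (fit_le fit)//; lia.
- by move=> s sa; apply: above => //; lia.
- by move=> s sb; apply: above.
Qed.

End IsotonicFit.

Lemma sum_by_parts (R : comNzRingType) (g nu : nat -> R) k :
  \sum_(0 <= j < k.+1) g j * nu j =
  (\sum_(0 <= j < k.+1) g j) * nu k -
  \sum_(0 <= j < k) (\sum_(0 <= l < j.+1) g l) * (nu j.+1 - nu j).
Proof.
elim: k => [|k ih]; first by rewrite !big_nat1 big_geq// subr0.
rewrite big_nat_recr//= ih [in RHS]big_nat_recr//= [X in _ = _ - X]big_nat_recr//=.
by ring.
Qed.

(** * Max-min formula and optimality of the isotonic fit *)

Section FitOptimality.
Context {R : realType} (m : nat) (d w lam : nat -> R).
Hypothesis w_gt0 : forall j, (j < m)%N -> 0 < w j.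
Hypothesis fit : isotonic_fit m d w lam.

Let sumw_gt0 s t : (s < t)%N -> (t <= m)%N -> 0 < \sum_(s <= j < t) w j.
Proof.
move=> st tm; rewrite big_nat big_ltn_cond// st leqnn ltr_pwDl ?w_gt0//; first lia.
by rewrite big_nat_cond sumr_ge0// => j Pj; rewrite ltW// w_gt0//; lia.
Qed.

(** The block around [i] gives a saddle point: with [s = a] every average is at least [lam i], and
    with [t = b.-1] (the last index is included) every average is at most [lam i]. *)
Lemma fit_maxmin i : (i < m)%N ->
  (lam i)%:E = \big[maxe/-oo%E]_(0 <= s < i.+1) \big[mine/+oo%E]_(i <= t < m)
    ((\sum_(s <= j < t.+1) d j) / (\sum_(s <= j < t.+1) w j))%:E.
Proof.
move=> im.
have [a [b [/andP[/andP[ai ib] bm] after _ before]]] := fit_block w_gt0 fit im.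
apply/eqP; rewrite eq_le; apply/andP; split.
  apply: (@bigmax_sup_seq _ _ _ _ _ a) => //; first by rewrite mem_index_iota.
  rewrite big_seq_cond; apply: le_bigmin; first by rewrite leey.
  move=> t; rewrite andbT mem_index_iota => /andP[it tm].
  rewrite lee_fin ler_pdivlMr; last by rewrite sumw_gt0//; lia.
  by apply: after; lia.
rewrite big_seq_cond; apply: bigmax_le; first by rewrite leNye.
move=> s; rewrite andbT mem_index_iota => /andP[_ si].
apply: (@bigmin_inf_seq _ _ _ _ _ b.-1) => //; first by rewrite mem_index_iota; lia.
have -> : b.-1.+1 = b by lia.
rewrite lee_fin ler_pdivrMr; last by rewrite sumw_gt0//; lia.
by apply: before; lia.
Qed.

Hypothesis d_ge0 : forall j, (j < m)%N -> 0 <= d j.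

(** [lam i] is at least the average of [d] from [i] to the end of its block. *)
Lemma fit_nneg i : (i < m)%N -> 0 <= lam i.
Proof.
move=> im.
have [a [b [/andP[/andP[ai ib] bm] _ _ before]]] := fit_block w_gt0 fit im.
have W_gt0 := sumw_gt0 ib bm.
rewrite -(pmulr_lge0 _ W_gt0); apply: le_trans (before i (ltnW ib)).
by rewrite big_nat_cond sumr_ge0// => j Pj; rewrite d_ge0//; lia.
Qed.

(** Same bound, now with a positive term; it keeps the loglikelihood of the fit above [-oo]. *)
Lemma fit_pos i : (i < m)%N -> 0 < d i -> 0 < lam i.
Proof.
move=> im di_gt0.
have [a [b [/andP[/andP[ai ib] bm] _ _ before]]] := fit_block w_gt0 fit im.
have W_gt0 := sumw_gt0 ib bm.
rewrite -(pmulr_lgt0 _ W_gt0); apply: lt_le_trans (before i (ltnW ib)).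
rewrite big_nat big_ltn_cond// ib leqnn ltr_pwDl//.
by rewrite big_nat_cond sumr_ge0// => j Pj; rewrite d_ge0//; lia.
Qed.

(** [lam i] is at most the average of [d] from the start of its block to [i]. Handles competitors
    that vanish at [i]. *)
Lemma fit_eq0 i : (i < m)%N -> (forall j, (j <= i)%N -> d j = 0) -> lam i = 0.
Proof.
move=> im d0; apply/eqP; rewrite eq_le fit_nneg// andbT.
have [a [b [/andP[/andP[ai ib] bm] after _ _]]] := fit_block w_gt0 fit im.
have W_gt0 : 0 < \sum_(a <= j < i.+1) w j by apply: sumw_gt0.
rewrite -(pmulr_lle0 _ W_gt0); apply: le_trans (after i.+1 _) _; first lia.
by rewrite big_nat big1// => j Pj; rewrite d0//; lia.
Qed.

(** After summation by parts, nonnegative partial sums meet nonnegative increments of [nu], and the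
    boundary term is 0: the residual lies in the polar cone of the nondecreasing sequences. *)
Lemma fit_polar (nu : nat -> R) :
  (forall j, (j.+1 < m)%N -> nu j <= nu j.+1) ->
  \sum_(0 <= j < m) (d j - w j * lam j) * nu j <= 0.
Proof.
case: fit => _ ge0 Sm _; case: m ge0 Sm => [|k] ge0 Sm nu_mono; first by rewrite big_geq.
rewrite sum_by_parts Sm mul0r sub0r oppr_le0 big_nat_cond sumr_ge0// => j.
rewrite andbT => /andP[_ jk]; rewrite mulr_ge0//; first by apply: ge0; rewrite ltnW.
by rewrite subr_ge0 nu_mono.
Qed.

(** After summation by parts, each term has a vanishing partial sum or a vanishing increment of
    [lam]. The arbitrary [phi] allows a logarithm modified at 0. *)
Lemma fit_orth (phi : R -> R) :
  \sum_(0 <= j < m) (d j - w j * lam j) * phi (lam j) = 0.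
Proof.
case: fit => _ _ Sm const; case: m Sm const => [|k] Sm const; first by rewrite big_geq.
rewrite (sum_by_parts _ (phi \o lam)) Sm mul0r sub0r big_nat big1 ?oppr0// => j /andP[_ jk].
by have [->|/= ->] := const j jk; rewrite ?mul0r// subrr mulr0.
Qed.

(** From [ln u < u - 1] for [u = y / x] other than 1. Since [ln 0 = 0] here, the case [y = 0 < x]
    has to be excluded. *)
Lemma mul_ln_sub_le (x y : R) : 0 <= x -> 0 <= y -> (y = 0 -> x = 0) ->
  x * ln y - y <= x * ln x - x ?= iff (y == x).
Proof.
rewrite le_eqVlt => /predU1P[<-|x_gt0] y_ge0 yx.
  by rewrite !mul0r !sub0r oppr0; split; rewrite ?oppr_le0// oppr_eq0.
have y_gt0 : 0 < y.
  rewrite lt_neqAle y_ge0 andbT eq_sym; apply: contraTneq x_gt0 => /yx ->.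
  by rewrite ltxx.
have [->|yNx] := eqVneq y x; first exact/leif_refl.
have : ln (y / x) < y / x - 1.
  rewrite -ltr_expR lnK ?posrE ?divr_gt0//.
  have := @expR_gt1Dx _ (y / x - 1); rewrite addrCA subrr addr0; apply.
  by rewrite subr_eq0 -(inj_eq (mulIf (lt0r_neq0 x_gt0))) divfK ?mul1r// gt_eqF.
rewrite -(ltr_pM2l x_gt0) ln_div ?posrE// !mulrBr mulr1.
rewrite [x * (y / x)]mulrC divfK ?gt_eqF// => H.
by apply/leifP; lra.
Qed.

Lemma fit_loglik_le (mu : nat -> R) :
  (forall j, (j < m)%N -> 0 <= mu j) ->
  (forall j, (j.+1 < m)%N -> mu j <= mu j.+1) ->
  (forall j, (j < m)%N -> 0 < d j -> 0 < mu j) ->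
  \sum_(0 <= j < m) (d j * ln (mu j) - w j * mu j) <=
    \sum_(0 <= j < m) (d j * ln (lam j) - w j * lam j)
    ?= iff [forall j : 'I_m, mu j == lam j].
Proof.
move=> mu_ge0 mu_mono mu_pos.
have mu_le j k : (j <= k)%N -> (k < m)%N -> mu j <= mu k.
  move=> /subnKC <-; elim: (k - j)%N => [|l ih] jl; first by rewrite addn0.
  by rewrite addnS in jl *; rewrite (le_trans (ih (ltnW jl)))// mu_mono.
have mu0 j : (j < m)%N -> mu j = 0 -> d j = 0 /\ lam j = 0.
  move=> jm mj0.
  have d0 k : (k <= j)%N -> d k = 0.
    move=> kj; apply/eqP; rewrite eq_le d_ge0 ?andbT; last lia.
    rewrite leNgt; apply/negP => /mu_pos; rewrite (leq_ltn_trans kj jm) => /(_ isT).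
    by rewrite ltNge -mj0 mu_le.
  by split; [exact: d0|exact: fit_eq0].
(* ln mu is made nondecreasing where mu vanishes; the corresponding terms are 0. *)
pose c := - \sum_(0 <= j < m) `|ln (mu j)|.
pose nu j := if mu j == 0 then c else ln (mu j).
have c_le j : (j < m)%N -> c <= ln (mu j).
  move=> jm; rewrite /c lerNl big_mkord (bigD1 (Ordinal jm))//=.
  rewrite (le_trans (ler_norm _))// normrN lerDl; exact: sumr_ge0.
have nu_mono j : (j.+1 < m)%N -> nu j <= nu j.+1.
  move=> jm; rewrite /nu; have jm' := ltnW jm.
  have [mj|mj] := eqVneq (mu j) 0; first by case: ifP => // _; exact: c_le.
  have mj_gt0 : 0 < mu j by rewrite lt_neqAle eq_sym mj mu_ge0.
  have mj1_gt0 : 0 < mu j.+1 by rewrite (lt_le_trans mj_gt0)// mu_mono.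
  by rewrite gt_eqF// ler_ln ?posrE// mu_mono.
(* [M] is the objective with [d j] replaced by [w j * lam j]; its terms are maximized one by one at
   [lam]. *)
pose M (x : nat -> R) := \sum_(0 <= j < m) w j * (lam j * ln (x j) - x j).
have E1 : \sum_(0 <= j < m) (d j * ln (mu j) - w j * mu j) =
    \sum_(0 <= j < m) (d j - w j * lam j) * nu j + M mu.
  rewrite -big_split; apply: eq_big_nat => j /andP[_ jm] /=; rewrite /nu.
  case: eqVneq => [mj|_]; last by ring.
  by have [-> ->] := mu0 j jm mj; rewrite mj; ring.
have E2 : \sum_(0 <= j < m) (d j * ln (lam j) - w j * lam j) = M lam.
  transitivity (\sum_(0 <= j < m) (d j - w j * lam j) * ln (lam j) + M lam).
    rewrite -big_split; apply: eq_big_nat => j _ /=; ring.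
  by rewrite fit_orth add0r.
have MP : M mu <= M lam ?= iff [forall j : 'I_m, mu j == lam j].
  rewrite /M !big_mkord; apply: leif_sum => j _.
  have [le_ eq_] := mul_ln_sub_le (fit_nneg (ltn_ord j)) (mu_ge0 j (ltn_ord j))
    (fun e => (mu0 j (ltn_ord j) e).2).
  have wj := w_gt0 (ltn_ord j).
  split; first by rewrite ler_pM2l.
  by rewrite (inj_eq (mulfI (lt0r_neq0 wj))) eq_.
have := fit_polar nu_mono; rewrite E1 E2 => P0; case: MP => MP MPeq.
split; first by lra.
apply/idP/idP => [/eqP e|]; first by rewrite -MPeq; apply/eqP; lra.
move=> all_eq; have := all_eq; rewrite -MPeq => /eqP ->.
apply/eqP; rewrite -[RHS]add0r; congr (_ + _).
(* When [mu] equals [lam], [nu] is a function of [lam], so the residual term vanishes by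
   orthogonality. *)
rewrite -[RHS](fit_orth (fun x => if x == 0 then c else ln x)).
by apply: eq_big_nat => j /andP[_ jm]; rewrite /nu (eqP (forallP all_eq (Ordinal jm))).
Qed.

End FitOptimality.

(** * Greatest convex minorants *)

Section ConvexMinorant.
Context {R : realType}.

Lemma convex_functionP (D : set R) (g : R -> R) :
  convex_function (D : set R^o) g <->
  forall t x y, 0 <= t <= 1 -> D x -> D y ->
    g (t * x + (1 - t) * y) <= t * g x + (1 - t) * g y.
Proof.
split=> [cvx t x y /andP[t0 t1] Dx Dy|cvx t x y].
  by apply: (cvx (Itv01 t0 t1) x y); rewrite inE.
by rewrite !inE => Dx Dy; apply: (cvx t%:num); rewrite ?ge0 ?le1.
Qed.

Lemma convex_le_chord (D : set R) (g : R -> R) (xa xb x : R) :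
  convex_function (D : set R^o) g -> D xa -> D xb -> xa < xb -> xa <= x <= xb ->
  g x <= (xb - x) / (xb - xa) * g xa + (x - xa) / (xb - xa) * g xb.
Proof.
move=> cvx Da Db ab /andP[ax xb'].
have ab_gt0 : 0 < xb - xa by rewrite subr_gt0.
have t0 : 0 <= (xb - x) / (xb - xa) by rewrite divr_ge0 ?subr_ge0// ltW.
have t1 : (xb - x) / (xb - xa) <= 1 by rewrite ler_pdivrMr// mul1r lerB.
have /convex_functionP/(_ _ xa xb _ Da Db) := cvx.
move=> /(_ ((xb - x) / (xb - xa))); rewrite t0 t1 => /(_ isT).
have -> : 1 - (xb - x) / (xb - xa) = (x - xa) / (xb - xa) by field; lra.
suff -> : (xb - x) / (xb - xa) * xa + (x - xa) / (xb - xa) * xb = x by [].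
by field; lra.
Qed.

Lemma convex_function_affine (D : set R) (c l x0 : R) :
  convex_function (D : set R^o) (fun x => c + l * (x - x0)).
Proof.
apply/convex_functionP => t x y _ _ _; rewrite le_eqVlt.
by apply/orP; left; apply/eqP; ring.
Qed.

Lemma gcm_eq (P : nat -> R * R) m x l :
  (exists2 g, convex_minorant P m g & g x = l) ->
  (forall g, convex_minorant P m g -> g x <= l) -> gcm P m x = l.
Proof.
move=> [g gP gx] ub; apply/eqP; rewrite eq_le; apply/andP; split.
  by apply: ge_sup => [|_ [h hP <-]]; [exists l, g|exact: ub].
apply: ub_le_sup; last by exists g.
by exists l => _ [h hP <-]; exact: ub.
Qed.

(** Between [P_i] and [P_(i+1)] the minorant is the line [L]: it is itself a convex minorant, and it
    is the chord between the contacts [P_a] and [P_b], which bounds every other one. The left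
    derivative at [P_(i+1)] sees only this segment. *)
Lemma gcm_left_derivative (P : nat -> R * R) m lam i :
  (forall j, (j < m)%N -> (P j).1 < (P j.+1).1) ->
  isotonic_fit m (fun j => (P j.+1).2 - (P j).2) (fun j => (P j.+1).1 - (P j).1) lam ->
  (i < m)%N -> left_derivative (gcm P m) (P i.+1).1 (lam i).
Proof.
move=> P_lt fit im.
have P_le j k : (j <= k)%N -> (k <= m)%N -> (P j).1 <= (P k).1.
  move=> /subnKC <-; elim: (k - j)%N => [|l ih] jl; first by rewrite addn0.
  by rewrite addnS in jl *; rewrite (le_trans (ih (ltnW jl)))// ltW// P_lt.
have w_gt0 j : (j < m)%N -> 0 < (P j.+1).1 - (P j).1 by move=> /P_lt; rewrite subr_gt0.
have [a [b [/andP[/andP[ai ib] bm] after left_ before]]] := fit_block w_gt0 fit im.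
pose L x := (P a).2 + lam i * (x - (P a).1).
have after' t : (a <= t <= m)%N -> L (P t).1 <= (P t).2.
  move=> at_; have := after t at_; rewrite !telescope_sumr /L; [lra|lia|lia].
have left' s : (s <= a)%N -> L (P s).1 <= (P s).2.
  move=> sa; have := left_ s sa; rewrite !telescope_sumr// /L; lra.
have Lb : L (P b).1 = (P b).2.
  apply/eqP; rewrite eq_le after' ?bm ?andbT/=; last lia.
  have ab : (a <= b)%N by lia.
  have := before a ab; rewrite !telescope_sumr// /L; lra.
have Lminor : convex_minorant P m L.
  split=> [|j jm]; first exact: convex_function_affine.
  by have [ja|aj] := leqP j a; [exact: left'|apply: after'; rewrite jm ltnW].
have gcmE x : (P i).1 <= x <= (P i.+1).1 -> gcm P m x = L x.
  move=> /andP[ix xi]; apply: gcm_eq; first by exists L.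
  move=> g [cvx g_le].
  have ax : (P a).1 <= x by rewrite (le_trans _ ix)// P_le//; lia.
  have xb : x <= (P b).1 by rewrite (le_trans xi)// P_le.
  have ab : (P a).1 < (P b).1.
    by rewrite (le_lt_trans (P_le _ _ ai _))// ?(lt_le_trans (P_lt i im))// ?P_le//; lia.
  have inD k : (k <= m)%N -> `[(P 0%N).1, (P m).1]%classic (P k).1.
    by move=> km /=; rewrite in_itv/= !P_le.
  have am : (a <= m)%N by lia.
  apply: le_trans (convex_le_chord cvx (inD a am) (inD b bm) ab _) _; first by rewrite ax.
  apply: le_trans (lerD (ler_wpM2l _ (g_le _ am)) (ler_wpM2l _ (g_le _ bm))) _.
  - by rewrite divr_ge0 ?subr_ge0// ltW.
  - by rewrite divr_ge0 ?subr_ge0// ltW.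
  - rewrite -Lb /L le_eqVlt; apply/orP; left; apply/eqP; field; lra.
apply: cvg_near_cst; near=> h.
have h_lt0 : h < 0 by near: h; exact: nbhs_left_lt.
have h_ge : (P i).1 - (P i.+1).1 <= h.
  by near: h; apply: nbhs_left_ge; rewrite subr_lt0 P_lt.
rewrite !gcmE; [|lra|lra].
rewrite /L; field; lra.
Unshelve. all: by end_near. Qed.

End ConvexMinorant.

(** * Cumulative hazards *)

Section CumulativeHazard.
Context {R : realType}.
Implicit Types (M a b c x : R) (lam : R -> R).

Definition cumhaz lam x : R := \int[lebesgue_measure]_(u in `[0, x]) lam u.

Lemma feasible_integrable M lam x : feasible M lam ->
  lebesgue_measure.-integrable `[0, x] (EFin \o lam).
Proof.
move=> [lam_mono lam_bnd].
have mlam : measurable_fun (`[0, x] : set R) lam.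
  (* Monotonicity holds on [[0, +oo[] only, so the argument is truncated at 0 to obtain a monotone
     function on the line. *)
  apply: (@eq_measurable_fun _ _ _ _ (`[0, x] : set R) (fun u => lam (Num.max 0 u))).
    by move=> u; rewrite inE/= in_itv/= => /andP[u0 _]; rewrite max_r.
  apply: nondecreasing_measurable => // u v uv.
  have max_ge0 z : 0 <= Num.max 0 z :> R by rewrite le_max lexx.
  apply: lam_mono; rewrite ?in_itv/= ?max_ge0//.
  by rewrite ge_max max_ge0 le_max uv orbT.
apply: measurable_bounded_integrable => //.
- by rewrite /= lebesgue_measure_itv/= lte_fin; case: ifP => //; rewrite ltry.
- exists M; split; first exact: num_real.
  move=> N MN u /=; rewrite in_itv/= => /andP[u0 _].
  have /andP[l0 lM] : 0 <= lam u <= M by apply: lam_bnd; rewrite in_itv/= u0.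
  by rewrite ger0_norm// (le_trans lM)// ltW.
Qed.

Lemma cumhazE M lam x : feasible M lam ->
  (\int[lebesgue_measure]_(u in `[0%R, x]) (lam u)%:E)%E = (cumhaz lam x)%:E.
Proof.
by move=> feas; rewrite fineK//; apply: integrable_fin_num => //; exact: feasible_integrable feas.
Qed.

(** Leaving out [b], where the hazard may jump, lets bounds valid on [[a, b)] suffice. *)
Lemma cumhazB M lam a b : feasible M lam -> 0 <= a <= b ->
  cumhaz lam b - cumhaz lam a = \int[lebesgue_measure]_(u in `[a, b[) lam u.
Proof.
move=> feas /andP[a0 ab].
have feasI := feasible_integrable _ feas.
have sub (i : interval R) : [set` i] `<=` `[0, b] ->
    lebesgue_measure.-integrable [set` i] (EFin \o lam).
  by move=> ib; apply: integrableS (feasI b).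
rewrite /cumhaz Rintegral_itvB// Rintegral_itv_obnd_cbnd ?Rintegral_itv_bndo_bndc//.
- by apply: sub => u /=; rewrite !in_itv/= => /andP[au ub]; rewrite (le_trans a0 au) ltW.
- by apply: sub => u /=; rewrite !in_itv/= => /andP[au ->]; rewrite (le_trans a0)// ltW.
Qed.

Lemma Rintegral_cst_itv a b c : a <= b ->
  \int[lebesgue_measure]_(u in `[a, b[) c = c * (b - a).
Proof.
move=> ab; rewrite Rintegral_cst//= lebesgue_measure_itv/= lte_fin.
by case: (ltgtP a b) ab => // -> _; rewrite subrr.
Qed.

Let cst_integrable a b c : lebesgue_measure.-integrable `[a, b[ (EFin \o cst c).
Proof.
apply: measurable_bounded_integrable => //.
  by rewrite /= lebesgue_measure_itv/= lte_fin; case: ifP => //; rewrite ltry.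
exists `|c|; split; first exact: num_real.
by move=> N cN u _; exact: ltW.
Qed.

Let feasible_integrable_itv M lam a b : feasible M lam -> 0 <= a ->
  lebesgue_measure.-integrable `[a, b[ (EFin \o lam).
Proof.
move=> feas a0; apply: integrableS (feasible_integrable b feas) => //.
by move=> u /=; rewrite !in_itv/= => /andP[au ub]; rewrite (le_trans a0 au) ltW.
Qed.

Lemma cumhaz_ge M lam a b c : feasible M lam -> 0 <= a <= b ->
  (forall x, a <= x < b -> c <= lam x) -> c * (b - a) <= cumhaz lam b - cumhaz lam a.
Proof.
move=> feas ab c_le; rewrite (cumhazB feas ab); case/andP: ab => a0 ab.
rewrite -Rintegral_cst_itv//.
by apply: (le_Rintegral _ (cst_integrable a b c) (feasible_integrable_itv b feas a0)).
Qed.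

Lemma cumhaz_le M lam a b c : feasible M lam -> 0 <= a <= b ->
  (forall x, a <= x < b -> lam x <= c) -> cumhaz lam b - cumhaz lam a <= c * (b - a).
Proof.
move=> feas ab le_c; rewrite (cumhazB feas ab); case/andP: ab => a0 ab.
rewrite -Rintegral_cst_itv//.
by apply: (le_Rintegral _ (feasible_integrable_itv b feas a0) (cst_integrable a b c)).
Qed.

Lemma cumhaz0 lam : cumhaz lam 0 = 0.
Proof. by rewrite /cumhaz set_itv1 Rintegral_set1. Qed.

Lemma feasible_mono M lam x y : feasible M lam -> 0 <= x -> x <= y -> lam x <= lam y.
Proof.
move=> [mono _] x0 xy; apply: mono => //; rewrite in_itv/= ?x0//.
by rewrite (le_trans x0).
Qed.

Lemma feasible_bnd M lam x : feasible M lam -> 0 <= x -> 0 <= lam x <= M.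
Proof. by move=> [_ bnd] x0; apply: bnd; rewrite in_itv/= x0. Qed.

Lemma cumhaz_nneg M lam x : feasible M lam -> 0 <= x -> 0 <= cumhaz lam x.
Proof.
move=> feas x0; have : 0 * (x - 0) <= cumhaz lam x - cumhaz lam 0.
  apply: (cumhaz_ge feas) => [|y /andP[y0 _]]; first by rewrite lexx.
  by case/andP: (feasible_bnd feas y0).
by rewrite mul0r cumhaz0 subr0.
Qed.

(* Bounding lam below by lam a before x and by lam x after x shows that a
   nondecreasing lam that integrates to lam a * (b - a) is constant on [a, b). *)
Lemma cumhaz_tight M lam a b x : feasible M lam -> 0 <= a -> a <= x < b ->
  cumhaz lam b - cumhaz lam a <= lam a * (b - a) -> lam x = lam a.
Proof.
move=> feas a0 /andP[ax xb] tight.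
have x0 := le_trans a0 ax.
have ax_le : lam a * (x - a) <= cumhaz lam x - cumhaz lam a.
  apply: (cumhaz_ge feas) => [|y /andP[ay _]]; first by rewrite a0.
  exact: feasible_mono feas a0 ay.
have xb_le : lam x * (b - x) <= cumhaz lam b - cumhaz lam x.
  apply: (cumhaz_ge feas) => [|y /andP[xy _]]; first by rewrite x0 ltW.
  exact: feasible_mono feas x0 xy.
have lax := feasible_mono feas a0 ax.
have bx_gt0 : 0 < b - x by rewrite subr_gt0.
have : (lam x - lam a) * (b - x) <= 0 by lra.
by rewrite pmulr_lle0// => ?; apply/eqP; rewrite eq_le lax andbT -subr_le0.
Qed.

End CumulativeHazard.

(** * The empirical processes and the likelihood of a sample *)

Section OrderStatistics.
Context {R : realType} {p n : nat} (X : n.-tuple (obs R p)).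

Lemma sum_ordered (V : nmodType) (F : obs R p -> V) :
  \sum_(o <- X) F o = \sum_(0 <= k < n) F (ordered X k.+1).
Proof.
rewrite -(perm_big _ (permEl (perm_sort (relpre (@time R p) <=%R) X))).
by rewrite (big_nth (obs0 R p)) size_sort size_tuple.
Qed.

Lemma ordered_mem k : (k < n)%N -> ordered X k.+1 \in X.
Proof.
by move=> kn; rewrite -(mem_sort (relpre (@time R p) <=%R)) mem_nth// size_sort size_tuple.
Qed.

Lemma Tord_lt j k : uniq [seq time o | o <- X] -> (j < k < n)%N ->
  Tord X j.+1 < Tord X k.+1.
Proof.
move=> time_uniq /andP[jk kn]; set s := sort (relpre (@time R p) <=%R) X.
have size_s : size s = n by rewrite size_sort size_tuple.
have srt : sorted <%R (map (@time R p) s).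
  rewrite lt_sorted_uniq_le sorted_map sort_sorted ?andbT; last by move=> ? ?; exact: le_total.
  by rewrite (perm_uniq (perm_map _ (permEl (perm_sort _ _)))).
have jn := ltn_trans jk kn.
rewrite /Tord /ordered/= -/s -!(nth_map (obs0 R p) 0) ?size_s//.
by rewrite (lt_sorted_ltn_nth 0 srt)// inE size_map size_s.
Qed.

Lemma Rintegral_emp (f : obs R p -> R) :
  measurable_fun setT f -> (forall o, 0 <= f o) ->
  \int[emp X]_o f o = n%:R^-1 * \sum_(o <- X) f o.
Proof.
move=> mf f0; have mEf : measurable_fun setT (EFin \o f) by exact/measurable_EFinP.
rewrite /Rintegral /emp ge0_integral_mscale//=; last by move=> o _; rewrite lee_fin.
rewrite ge0_integral_measure_sum//; last by move=> o _; rewrite lee_fin.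
rewrite (eq_bigr (fun k : 'I_n => (f (nth (obs0 R p) X k))%:E)); last first.
  by move=> k _; rewrite integral_dirac//= diracT mul1e.
by rewrite sumEFin/= [in RHS](big_nth (obs0 R p)) size_tuple big_mkord.
Qed.

End OrderStatistics.

(** * The processes [Wn] and [Vn] as finite sums *)

Section ProcessFormulas.
Context {R : realType} {p n : nat} (X : n.-tuple (obs R p)) (beta : p.-tuple R).

Lemma measurable_time : measurable_fun setT (@time R p).
Proof. by apply: measurableT_comp => //; exact: measurable_fst. Qed.

Lemma measurable_dotp : measurable_fun setT (fun o : obs R p => dotp beta (covar o)).
Proof.
apply: measurable_sum => k; apply: measurable_funM => //.
apply: (measurableT_comp (@measurable_tnth _ _ _ k)) => //; exact: measurable_snd.
Qed.

(** The outer maximum accounts for empty intervals; under the empirical integral [T] is the time of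
    any [o], possibly negative. *)
Lemma Rintegral_le_indic (x T : R) :
  \int[lebesgue_measure]_(s in `[0, x]) (s <= T)%R%:R = Num.max 0 (Num.min x T).
Proof.
transitivity (\int[lebesgue_measure]_(s in `[0, x]) \1_(`]-oo, T]) s : R).
  by apply: eq_Rintegral => s _; rewrite indicE mem_setE in_itv.
rewrite /Rintegral integral_indic//.
have -> : `]-oo, T]%classic `&` `[0, x]%classic = `[0, Num.min x T]%classic :> set R.
  apply/seteqP; split=> s /=; rewrite !in_itv/= le_min.
    by move=> [-> /andP[-> ->]].
  by move=> /andP[-> /andP[-> ->]].
rewrite /= lebesgue_measure_itv/= lte_fin; case: ltP => [h|h].
  by rewrite /= subr0.
by [].
Qed.

Lemma Wn_sum x : (forall o, o \in X -> 0 <= time o) -> 0 <= x ->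
  Wn X beta x =
  n%:R^-1 * \sum_(0 <= l < n) expR (dotp beta (Zord X l.+1)) * Num.min x (Tord X l.+1).
Proof.
move=> time_ge0 x0; rewrite /Wn.
under eq_Rintegral => o _ do rewrite Rintegral_le_indic.
rewrite Rintegral_emp.
- rewrite sum_ordered; congr (_ * _); apply: eq_big_nat => l /andP[_ ln].
  by rewrite max_r// le_min x0 time_ge0// ordered_mem.
- apply: measurable_funM; first by apply: measurableT_comp => //; exact: measurable_dotp.
  by apply: measurable_maxr => //; apply: measurable_minr => //; exact: measurable_time.
- by move=> o; rewrite mulr_ge0 ?expR_ge0// le_max lexx.
Qed.

Lemma Vn_sum x : Vn X x =
  n%:R^-1 * \sum_(0 <= l < n) (Dord X l.+1)%:R * (Tord X l.+1 < x)%R%:R.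
Proof.
rewrite /Vn Rintegral_emp; first by rewrite sum_ordered.
- have mb (f : obs R p -> bool) : measurable_fun setT f ->
      measurable_fun setT (fun o => (f o)%:R : R).
    by move=> mf; apply: (measurableT_comp (f := fun b : bool => b%:R : R)).
  apply: measurable_funM; apply: mb.
    by apply: measurableT_comp => //; exact: measurable_fst.
  by apply: measurable_fun_ltr => //; exact: measurable_time.
- by move=> o; rewrite mulr_ge0.
Qed.

End ProcessFormulas.

(** * Increments of the cumulative sum diagram *)

Section SampleFit.
Context {R : realType} {p m : nat} (X : m.+1.-tuple (obs R p)) (beta : p.-tuple R).

Definition ord_time k : R := Tord X k.+1.
Definition ord_event k : R := (Dord X k.+1)%:R.
Definition ord_risk k : R := expR (dotp beta (Zord X k.+1)).
Definition risk_from k : R := \sum_(k <= l < m.+1) ord_risk l.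
(** Only the observations from [k.+1] on are at risk throughout the interval; up to the factor
    [1 / n] this is the horizontal increment of the diagram. *)
Definition exposure k : R := (ord_time k.+1 - ord_time k) * risk_from k.+1.

Local Notation t := ord_time.
Local Notation d := ord_event.
Local Notation e := ord_risk.
Local Notation tail := risk_from.
Local Notation w := exposure.

Hypothesis time_ge0 : forall o : obs R p, o \in X -> 0 <= time o.
Hypothesis time_uniq : uniq [seq time o | o <- X].

Let t_lt j k : (j < k)%N -> (k < m.+1)%N -> t j < t k.
Proof. by move=> jk km; rewrite Tord_lt// jk. Qed.

Let t_le j k : (j <= k)%N -> (k < m.+1)%N -> t j <= t k.
Proof. by rewrite leq_eqVlt => /predU1P[->//|jk] km; rewrite ltW// t_lt. Qed.

Let t_ge0 k : (k < m.+1)%N -> 0 <= t k.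
Proof. by move=> km; rewrite time_ge0// ordered_mem. Qed.

Let tail_gt0 k : (k < m.+1)%N -> 0 < tail k.
Proof.
move=> km; rewrite /risk_from big_ltn// ltr_pwDl ?expR_gt0//.
by rewrite sumr_ge0// => l _; rewrite expR_ge0.
Qed.

Lemma exposure_gt0 k : (k < m)%N -> 0 < w k.
Proof. by move=> km; rewrite mulr_gt0 ?tail_gt0// subr_gt0 t_lt. Qed.

Let d_ge0 k : 0 <= d k. Proof. exact: ler0n. Qed.

(** Observations up to [k] contribute equally at both ends; the later ones are exposed over the
    whole interval. *)
Lemma Wn_increment k : (k < m)%N ->
  Wn X beta (t k.+1) - Wn X beta (t k) = m.+1%:R^-1 * w k.
Proof.
move=> km; have km1 : (k < m.+1)%N by rewrite ltnW.
rewrite !Wn_sum ?t_ge0// -mulrBr -sumrB; congr (_ * _).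
rewrite (@big_cat_nat _ _ _ k.+1)//= big_nat big1 ?add0r => [|l /andP[_ lk]].
  rewrite /exposure mulr_sumr; apply: eq_big_nat => l /andP[kl lm].
  rewrite -/(t l) -/(e l) -mulrBr mulrC; congr (_ * _).
  by rewrite !min_l// t_le// ltnW.
by rewrite -/(t l) !min_r ?subrr// t_le// ltnW.
Qed.

(** The strict inequality in [Vn] leaves out the event at [t k] itself. *)
Lemma Vn_Tord k : (k < m.+1)%N ->
  Vn X (t k) = m.+1%:R^-1 * \sum_(0 <= l < k) d l.
Proof.
move=> km; rewrite Vn_sum; congr (_ * _).
rewrite (@big_cat_nat _ _ _ k)//=; last exact: ltnW.
rewrite [X in _ + X]big_nat [X in _ + X]big1 ?addr0 => [|l /andP[kl lm]].
  by apply: eq_big_nat => l /andP[_ lk]; rewrite -/(t l) t_lt// mulr1.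
by rewrite -/(t l) ltNge t_le// mulr0.
Qed.

(** The separate definition of [P_0] agrees with the general formula, as [Vn] vanishes at the first
    time. *)
Lemma csd_Tord k : (k < m.+1)%N ->
  (csd X beta k).1 = Wn X beta (t k) - Wn X beta (t 0) /\
  (csd X beta k).2 = Vn X (t k).
Proof.
by case: k => [|k] km; split=> //; rewrite ?subrr// Vn_Tord// big_geq// mulr0.
Qed.

Lemma csd_increment k : (k < m)%N ->
  (csd X beta k.+1).1 - (csd X beta k).1 = m.+1%:R^-1 * w k /\
  (csd X beta k.+1).2 - (csd X beta k).2 = m.+1%:R^-1 * d k.
Proof.
move=> km; have km1 : (k < m.+1)%N by rewrite ltnW.
have [x0 y0] := csd_Tord km1; have [x1 y1] := csd_Tord (k := k.+1) km.
split; first by rewrite x0 x1 opprB addrA subrK; exact: Wn_increment.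
rewrite y0 y1 (Vn_Tord km1) (Vn_Tord (k := k.+1) km) -mulrBr big_nat_recr//.
by rewrite /= addrAC subrr add0r.
Qed.

(** * Reduction of the loglikelihood to the isotonic problem *)

Section Likelihood.
Variable lam : nat -> R.
Hypothesis fit : isotonic_fit m d w lam.

Let logterm k (y : R) := d k * ln y + d k * dotp beta (Zord X k.+1).
(** For feasible hazards, this amounts to finiteness of the loglikelihood. *)
Let regular (mu : R -> R) := forall k, (k < m.+1)%N -> 0 < d k -> 0 < mu (t k).

Let d01 k : d k = 1 \/ d k = 0.
Proof. by rewrite /ord_event; case: Dord; [left|right]. Qed.

Lemma loglik_fin M mu : feasible M mu -> regular mu ->
  loglik X beta mu =
  (\sum_(0 <= k < m.+1) (logterm k (mu (t k)) - e k * cumhaz mu (t k)))%:E.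
Proof.
move=> feas reg; rewrite /loglik sum_ordered -sumEFin; apply: eq_big_nat => k /andP[_ km].
rewrite (cumhazE _ feas) -/(Tord X k.+1) -/(t k) -/(Dord X k.+1) -/(d k) -/(Zord X k.+1) -/(e k).
rewrite /logterm !EFinD EFinN !EFinM; congr (_ + _ - _)%E.
by case: (d01 k) => dk; [rewrite lne_EFin// reg// dk|rewrite dk !mul0e].
Qed.

Lemma loglik_regular M mu : feasible M mu -> loglik X beta mu != -oo%E -> regular mu.
Proof.
move=> feas; apply: contraNP => /existsNP[k /not_implyP[km /not_implyP[dk /negP]]].
rewrite -leNgt => mu0; apply/eqP/esum_eqNyP.
exists (ordered X k.+1); split=> //; first exact: ordered_mem.
rewrite (cumhazE _ feas) -/(Tord X k.+1) -/(t k) -/(Dord X k.+1) -/(d k).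
have -> : d k = 1 by case: (d01 k) dk => // ->; rewrite ltxx.
by rewrite /= mu0 mul1e.
Qed.

(** By parts, each increment of [h] is weighted by the total risk of the observations after it. *)
Let ecumhaz_sum (h : nat -> R) :
  \sum_(0 <= k < m.+1) e k * h k =
  tail 0 * h 0%N + \sum_(0 <= k < m) tail k.+1 * (h k.+1 - h k).
Proof.
have hm : h m = h 0%N + \sum_(0 <= k < m) (h k.+1 - h k).
  by rewrite telescope_sumr// addrC subrK.
rewrite sum_by_parts hm mulrDr -addrA; congr (_ + _).
rewrite mulr_sumr -sumrB; apply: eq_big_nat => k /andP[_ km].
rewrite -mulrBl /risk_from (@big_cat_nat _ _ _ k.+1)//=; last exact: ltnW.
by rewrite addrAC subrr add0r.
Qed.

(** For large [M], the maximal loglikelihood under the bound [M]: fitted values before the last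
    time, [M] there. *)
Let lik (M : R) :=
  \sum_(0 <= k < m) (d k * ln (lam k) - w k * lam k) + d m * ln M +
  \sum_(0 <= k < m.+1) d k * dotp beta (Zord X k.+1).

(** Loss from exceeding, between two times, the value taken at the left one. *)
Let gap (mu : R -> R) k := tail k.+1 *
  (cumhaz mu (t k.+1) - cumhaz mu (t k) - mu (t k) * (t k.+1 - t k)).

(** Splits the loglikelihood into terms in the values at the times and two penalties, for the hazard
    before [t 0] and for growth inside the intervals. *)
Let loglikE M mu : feasible M mu -> regular mu ->
  loglik X beta mu =
  (\sum_(0 <= k < m) (d k * ln (mu (t k)) - w k * mu (t k)) + d m * ln (mu (t m)) +
   \sum_(0 <= k < m.+1) d k * dotp beta (Zord X k.+1) -
   (tail 0 * cumhaz mu (t 0) + \sum_(0 <= k < m) gap mu k))%:E.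
Proof.
move=> feas reg; rewrite (loglik_fin feas reg); congr EFin.
rewrite sumrB (ecumhaz_sum (fun k => cumhaz mu (t k))) big_split/=.
rewrite (big_nat_recr m _ (fun k => d k * ln _))//=.
have -> : \sum_(0 <= k < m) tail k.+1 * (cumhaz mu (t k.+1) - cumhaz mu (t k)) =
    \sum_(0 <= k < m) gap mu k + \sum_(0 <= k < m) w k * mu (t k).
  by rewrite -big_split; apply: eq_bigr => k _; rewrite /gap /exposure/=; ring.
rewrite sumrB; ring.
Qed.

Let gap_ge0 M mu k : feasible M mu -> (k < m)%N -> 0 <= gap mu k.
Proof.
move=> feas km; have k0 : 0 <= t k by rewrite t_ge0// ltnW.
rewrite mulr_ge0 ?(ltW (tail_gt0 _))// subr_ge0.
apply: (cumhaz_ge feas) => [|x /andP[kx _]]; first by rewrite k0 t_le.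
exact: feasible_mono feas k0 kx.
Qed.

Let cumhaz_t0_ge0 M mu : feasible M mu -> 0 <= tail 0 * cumhaz mu (t 0).
Proof.
by move=> feas; rewrite mulr_ge0 ?(ltW (tail_gt0 _)) ?(cumhaz_nneg feas) ?t_ge0.
Qed.

(** The deficit to [lik M] is a sum of nonnegative losses: in the isotonic problem, at the last
    time, before [t 0], and in the gaps. If it is not positive, each loss vanishes. The value at
    [t m] is left open here; [sieve_max] prescribes it. *)
Let loglik_le M mu : feasible M mu -> regular mu ->
  (loglik X beta mu <= (lik M)%:E)%E /\
  (((lik M)%:E <= loglik X beta mu)%E ->
    [/\ cumhaz mu (t 0) <= 0, forall k, (k < m)%N -> mu (t k) = lam k &
        forall k, (k < m)%N ->
          cumhaz mu (t k.+1) - cumhaz mu (t k) <= mu (t k) * (t k.+1 - t k)]).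
Proof.
move=> feas reg; rewrite (loglikE feas reg) !lee_fin /lik.
have mu_mono j : (j.+1 < m)%N -> mu (t j) <= mu (t j.+1).
  move=> jm; apply: (feasible_mono feas); first by rewrite t_ge0//; lia.
  by rewrite t_le//; lia.
have mu_ge0 j : (j < m)%N -> 0 <= mu (t j).
  by move=> jm; case/andP: (feasible_bnd feas (t_ge0 (ltnW jm))).
have mu_pos j : (j < m)%N -> 0 < d j -> 0 < mu (t j).
  by move=> jm; exact: reg (ltnW jm).
have [le_fit eq_fit] :=
  fit_loglik_le exposure_gt0 fit (fun j _ => d_ge0 j) mu_ge0 mu_mono mu_pos.
have H0 := cumhaz_t0_ge0 feas.
have le_last : d m * ln (mu (t m)) <= d m * ln M.
  case: (d01 m) => dm; last by rewrite dm !mul0r.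
  have mu_gt0 : 0 < mu (t m) by apply: reg; rewrite ?dm.
  have /andP[_ muM] := feasible_bnd feas (t_ge0 (ltnSn m)).
  by rewrite ler_pM2l ?dm// ler_ln ?posrE// (lt_le_trans mu_gt0).
have gaps : 0 <= \sum_(0 <= k < m) gap mu k.
  by rewrite big_mkord sumr_ge0// => k _; exact: gap_ge0 feas _.
split=> [|tight]; first by lra.
have gap0 : \sum_(0 <= k < m) gap mu k = 0 by lra.
split.
- by rewrite -(pmulr_rle0 _ (tail_gt0 (ltn0Sn m))); lra.
- have : [forall j : 'I_m, mu (t j) == lam j] by rewrite -eq_fit; apply/eqP; lra.
  by move=> /forallP eq_all k km; apply/eqP/(eq_all (Ordinal km)).
- move=> k km; move: gap0; rewrite big_mkord => /psumr_eq0P => gap0.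
  have /eqP := gap0 (fun j _ => gap_ge0 feas (ltn_ord j)) (Ordinal km) isT.
  by rewrite mulf_eq0 gt_eqF ?tail_gt0//= subr_eq0 => /eqP ->.
Qed.

(** As [lam] is nonnegative and nondecreasing, the maximum selects the latest value, with default 0
    before [t 0]; monotonicity in [x] below [t m] is growth of the index set. *)
Definition step M (x : R) : R :=
  if t m <= x then M else \big[Num.max/0]_(k < m | t k <= x) lam k.

Let lam_ge0 k : (k < m)%N -> 0 <= lam k.
Proof. by move=> km; exact: (fit_nneg exposure_gt0 fit (fun j _ => d_ge0 j)). Qed.

Lemma step_lt M x : x < t 0 -> step M x = 0.
Proof.
move=> x0; rewrite /step ifN -?ltNge ?(lt_le_trans x0) ?t_le// big_pred0// => k.
by apply/negbTE; rewrite -ltNge (lt_le_trans x0)// t_le// ltnS ltnW.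
Qed.

Lemma step_ge M x : t m <= x -> step M x = M.
Proof. by rewrite /step => ->. Qed.

Lemma step_itv M k x : (k < m)%N -> t k <= x < t k.+1 -> step M x = lam k.
Proof.
move=> km /andP[kx xk]; rewrite /step ifN -?ltNge ?(lt_le_trans xk) ?t_le//.
apply/eqP; rewrite eq_le; apply/andP; split; last exact: (le_bigmax_cond _ _ (j := Ordinal km)).
apply: bigmax_le => [|j jx]; first exact: lam_ge0.
apply: (fit_le fit) => //; rewrite leqNgt; apply/negP => kj.
by move: (le_lt_trans jx xk); rewrite ltNge t_le// ltnS ltnW.
Qed.

Let locate x : [\/ x < t 0, exists2 k, (k < m)%N & t k <= x < t k.+1 | t m <= x].
Proof.
have [x0|x0] := ltP x (t 0); first by constructor 1.
have [mx|xm] := leP (t m) x; first by constructor 3.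
constructor 2; have ex : exists k, (k < m)%N && (t k <= x).
  by exists 0%N; rewrite x0 andbT lt0n; apply: contraTneq xm => ->; rewrite -leNgt.
have ub k : (k < m)%N && (t k <= x) -> (k <= m)%N by case/andP => /ltnW.
case: (ex_maxnP ex ub) => k /andP[km kx] kmax; exists k => //.
rewrite kx ltNge; apply/negP => k1x.
have [k1m|k1m] := ltnP k.+1 m; first by have := kmax k.+1; rewrite k1m k1x ltnn => /(_ isT).
by have E : k.+1 = m; [lia|move: xm; rewrite ltNge -E k1x].
Qed.

(** * Existence and uniqueness of the bounded maximizer *)

Section Sieve.
Variable M : R.
Hypothesis M_gt0 : 0 < M.
Hypothesis M_ge : lam m.-1 <= M.

Let lam_leM k : (k < m)%N -> lam k <= M.
Proof. by move=> km; rewrite (le_trans _ M_ge)// (fit_le fit)//; lia. Qed.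

Lemma step_feasible : feasible M (step M).
Proof.
have bnd x : 0 <= step M x <= M.
  case: (locate x) => [/step_lt|[k km /step_itv]|/step_ge] -> //.
  - by rewrite lexx ltW.
  - by rewrite lam_ge0// lam_leM.
  - by rewrite lexx ltW.
split=> [x y _ _ xy|x _]; last exact: bnd.
have [my|ym] := leP (t m) y; first by rewrite (step_ge _ my); case/andP: (bnd x).
rewrite /step !ifN -?ltNge// ?(le_lt_trans xy)//.
by apply: sub_bigmax => k kx; exact: le_trans xy.
Qed.

Let step_t k : (k < m)%N -> step M (t k) = lam k.
Proof. by move=> km; apply: step_itv => //; rewrite lexx t_lt. Qed.

Let step_regular : regular (step M).
Proof.
move=> k; rewrite ltnS leq_eqVlt => /predU1P[->|km] dk; first by rewrite step_ge.
by rewrite step_t// (fit_pos exposure_gt0 fit (fun j _ => d_ge0 j)).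
Qed.

(** Both penalties vanish: the step is 0 before [t 0] and constant on each interval. *)
Let loglik_step : loglik X beta (step M) = (lik M)%:E.
Proof.
have feas := step_feasible.
rewrite (loglikE feas step_regular) step_ge// /lik; congr EFin.
have -> : cumhaz (step M) (t 0) = 0.
  have t0_ge0 := t_ge0 (ltn0Sn m).
  apply/eqP; rewrite eq_le (cumhaz_nneg feas)// andbT.
  have : cumhaz (step M) (t 0) - cumhaz (step M) 0 <= 0 * (t 0 - 0).
    by apply: (cumhaz_le feas) => [|x /andP[_ x0]]; rewrite ?lexx// step_lt.
  by rewrite cumhaz0 mul0r subr0.
rewrite mulr0 add0r.
have -> : \sum_(0 <= k < m) gap (step M) k = 0.
  rewrite big_nat big1// => k km; apply/eqP; rewrite eq_le (gap_ge0 feas)// andbT.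
  rewrite /gap pmulr_rle0 ?tail_gt0// subr_le0 step_t//.
  apply: (cumhaz_le feas) => [|x kx]; first by rewrite t_ge0 ?t_le// ltnW.
  by rewrite (step_itv _ km).
rewrite subr0; congr (_ + _ + _).
by apply: eq_big_nat => k km; rewrite step_t.
Qed.

(** Another maximizer also attains [lik M], so all its losses vanish, which determines it before
    [t m]; from there on its value is prescribed. *)
Lemma step_sieve_mle : sieve_mle X beta M (step M).
Proof.
have step_max : sieve_max X beta M (step M).
  split=> [|mu feas|x x0]; [exact: step_feasible| |exact: step_ge].
  have [->|fin] := eqVneq (loglik X beta mu) -oo%E; first exact: leNye.
  by rewrite loglik_step; case: (loglik_le feas (loglik_regular feas fin)).
split=> // mu [feas mu_max mu_top] x.
rewrite in_itv/= andbT => x0.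
have tight : ((lik M)%:E <= loglik X beta mu)%E.
  by rewrite -loglik_step; apply: mu_max; exact: step_feasible.
have fin : loglik X beta mu != -oo%E by apply: contraTneq tight => ->.
have [_ /(_ tight)[H0 mu_lam Hk]] := loglik_le feas (loglik_regular feas fin).
case: (locate x) => [xt|[k km kx]|mx]; last by rewrite step_ge// mu_top.
- rewrite step_lt//; have /andP[mu0 _] := feasible_bnd feas x0.
  apply/eqP; rewrite eq_le mu0 andbT.
  (* By monotonicity a positive [mu x] would give a positive integral from [x] to [t 0]. *)
  have : mu x * (t 0 - x) <= cumhaz mu (t 0) - cumhaz mu x.
    apply: (cumhaz_ge feas) => [|y /andP[xy _]]; first by rewrite x0 ltW.
    exact: feasible_mono feas x0 xy.
  have := cumhaz_nneg feas x0 => ? ?; have tx : 0 < t 0 - x by rewrite subr_gt0.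
  by rewrite -(pmulr_lle0 _ tx); lra.
- rewrite (step_itv _ km kx) -mu_lam//.
  exact: (cumhaz_tight feas (t_ge0 (ltnW km)) kx (Hk k km)).
Qed.

End Sieve.

(** * The limit as the bound tends to infinity *)

Let top : R := Num.max 0 (lam m.-1).

(** The family in [is_npmle] is arbitrary, but by uniqueness it agrees with [step M] on [[0, +oo)]
    for large [M]; the value of [step M] at [x] does not depend on [M] before [t m] and is [M] from
    there on. *)
Lemma is_npmleP (L : R -> \bar R) : is_npmle X beta L <->
  [/\ forall x, 0 <= x -> x < t 0 -> L x = 0%E,
      forall k x, (k < m)%N -> 0 <= x -> t k <= x < t k.+1 -> L x = (lam k)%:E &
      forall x, 0 <= x -> t m <= x -> L x = +oo%E].
Proof.
have mle_near : \forall M \near +oo, sieve_mle X beta M (step M).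
  near=> M; have : top < M by near: M; apply: nbhs_pinfty_gt; exact: num_real.
  by rewrite gt_max => /andP[M0 /ltW lamM]; exact: step_sieve_mle.
have cvg_lt x : x < t 0 -> (step M x)%:E @[M --> +oo] --> 0%E.
  by move=> x0; apply: cvg_near_cst; near=> M; rewrite step_lt.
have cvg_itv k x : (k < m)%N -> t k <= x < t k.+1 ->
    (step M x)%:E @[M --> +oo] --> (lam k)%:E.
  by move=> km kx; apply: cvg_near_cst; near=> M; rewrite (step_itv _ km kx).
have cvg_ge x : t m <= x -> (step M x)%:E @[M --> +oo] --> +oo%E.
  by move=> mx; apply/cvgeryP; under eq_fun do rewrite step_ge//; exact: cvg_id.
split.
- move=> [lamM [lamM_mle lamM_cvg]].
  have L_uniq x l : 0 <= x -> (step M x)%:E @[M --> +oo] --> l -> L x = l.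
    move=> x0 step_cvg; apply: (cvg_unique (@ereal_hausdorff R) (lamM_cvg x x0)).
    apply: cvg_trans step_cvg; apply: near_eq_cvg; near=> M.
    have [step_max _] : sieve_mle X beta M (step M) by near: M.
    have [_ uniq_mle] : sieve_mle X beta M (lamM M) by near: M.
    by rewrite (uniq_mle _ step_max)// in_itv/= x0.
  split=> [x x0 /cvg_lt|k x km x0 /(cvg_itv _ _ km)|x x0 /cvg_ge]; exact: L_uniq.
- move=> [L_lt L_itv L_ge]; exists step; split=> // x x0.
  case: (locate x) => [xt|[k km kx]|mx].
  + by rewrite L_lt//; exact: cvg_lt.
  + by rewrite (L_itv k)//; exact: cvg_itv.
  + by rewrite L_ge//; exact: cvg_ge.
Unshelve. all: by end_near. Qed.

End Likelihood.

End SampleFit.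

Theorem lemma1 (R : realType) (p n : nat) (n_gt0 : (0 < n)%N)
    (X : n.-tuple (obs R p))
    (time_ge0 : forall o : obs R p, o \in X -> 0 <= time o)
    (time_uniq : uniq [seq time o | o <- X])
    (beta : p.-tuple R) :
  exists lamhat : nat -> R,
    [/\ (* lamhat i is the left derivative of the minorant at P_i *)
        forall i : nat, (1 <= i < n)%N ->
          left_derivative (gcm (csd X beta) n.-1) (csd X beta i).1 (lamhat i),
        (* the NPMLE exists, is unique on [0, +oo) and has the stated form *)
        forall lam : R -> \bar R, is_npmle X beta lam <->
          [/\ forall x : R, 0 <= x -> x < Tord X 1 -> lam x = 0%E,
              forall (i : nat) (x : R), (1 <= i < n)%N -> 0 <= x ->
                Tord X i <= x < Tord X i.+1 -> lam x = (lamhat i)%:E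
            & forall x : R, 0 <= x -> Tord X n <= x -> lam x = +oo%E]
      & forall i : nat, (1 <= i < n)%N ->
          (lamhat i)%:E =
          \big[maxe/-oo%E]_(1 <= s < i.+1) \big[mine/+oo%E]_(i <= t < n)
            ((\sum_(s <= j < t.+1) (Dord X j)%:R) /
             (\sum_(s <= j < t.+1) (Tord X j.+1 - Tord X j) *
                \sum_(j.+1 <= l < n.+1) expR (dotp beta (Zord X l))))%:E].
Proof.
case: n n_gt0 X time_ge0 time_uniq => [//|m] _ Y Y_ge0 Y_uniq.
have w_gt0 k : (k < m)%N -> 0 < exposure Y beta k by exact: exposure_gt0.
have [lam fit] := fit_exists (ord_event Y) w_gt0.
have c_gt0 : 0 < m.+1%:R^-1 :> R by rewrite invr_gt0.
have incr k (km : (k < m)%N) := csd_increment beta Y_ge0 Y_uniq km.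
have csd_fit := fit_scale c_gt0 (fun k km => (incr k km).2) (fun k km => (incr k km).1) fit.
have csd_lt k : (k < m)%N -> (csd Y beta k).1 < (csd Y beta k.+1).1.
  by move=> km; rewrite -subr_gt0 (incr k km).1 mulr_gt0// w_gt0.
(* The fit is indexed from 0, the statement from 1. *)
exists (fun i => lam i.-1); split.
- by move=> [//|i] /= im; exact: gcm_left_derivative csd_lt csd_fit im.
- move=> L; rewrite (is_npmleP Y_ge0 Y_uniq fit); split=> -[L_lt L_itv L_ge]; split=> //.
  + by move=> [//|i] x /= im; exact: L_itv.
  + by move=> k x km; exact: (L_itv k.+1).
- move=> [//|i] /= im; rewrite (fit_maxmin w_gt0 fit im) big_add1.
  apply: eq_bigr => s _; rewrite big_add1; apply: eq_bigr => t _.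
  rewrite !big_add1; congr (_ / _)%:E; apply: eq_bigr => j _.
  by rewrite big_add1.
Qed.
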